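(* Let $n,k$ be integers with $n\ge 3$ and $1\le k<n/2$. If the double generalized Petersen graph $\mathrm{DP}(n,k)$ is $[1,\lambda,8]$-cycle regular for some integer $\lambda$, then $\mathrm{DP}(n,k)$ is isomorphic to $\mathrm{DP}(5,2)$ or to $\mathrm{DP}(10,2)$.
   Context: For integers $n\ge 3$ and $1\le k<n/2$, the double generalized Petersen graph $\mathrm{DP}(n,k)$ has vertex set $\{u_i,w_i,x_i,y_i : i=0,\dots,n-1\}$ and edge set consisting of the outer edges $u_iu_{i+1}$ and $x_ix_{i+1}$, the inner edges $w_iy_{i+k}$ and $y_iw_{i+k}$, and the spoke edges $u_iw_i$ and $x_iy_i$, for $i=0,\dots,n-1$, with subscripts taken modulo $n$. For integers $l,\lambda,m$, a simple graph is $[l,\lambda,m]$-cycle regular if every path on $l+1$ vertices belongs to exactly $\lambda$ different cycles of length $m$; in particular $[1,\lambda,8]$-cycle regular means every edge lies on exactly $\lambda$ distinct $8$-cycles. *)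

(* Defs.v *)
From HB Require Import structures.
From mathcomp Require Import all_boot.

Set Implicit Arguments.
Unset Strict Implicit.
Unset Printing Implicit Defensive.

(** A simple graph is a symmetric irreflexive relation on a [finType]. *)

Definition graph_iso (V1 V2 : finType) (e1 : rel V1) (e2 : rel V2) : Prop :=
  exists2 f : V1 -> V2, bijective f & forall x y, e2 (f x) (f y) = e1 x y.

Section CycleRegular.
Variables (V : finType) (e : rel V).

Definition cycle_edges (c : seq V) : {set {set V}} :=
  [set [set x; next c x] | x in c].

(** Cycles are subgraphs, each given by its edge set, so that rotations and
    reversals of a closed walk yield the same cycle. *)
Definition is_cycle (m : nat) (C : {set {set V}}) : bool :=
  (2 < m) && [exists c : m.-tuple V, ucycleb e c && (C == cycle_edges c)].

(** The path is [x :: p].  The vertex condition matters only when [p] is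
    empty. *)
Definition path_in_cycle (x : V) (p : seq V) (C : {set {set V}}) : bool :=
  all [in cover C] (x :: p) && all [in C] (pairmap (fun a b => [set a; b]) x p).

Definition cycle_regular (l lambda m : nat) : Prop :=
  forall (x : V) (p : seq V), size p = l -> path e x p -> uniq (x :: p) ->
  #|[set C | is_cycle m C & path_in_cycle x p C]| = lambda.

End CycleRegular.

Variant dp_kind := U | W | X | Y.

Definition bool2_of_kind (t : dp_kind) : bool * bool :=
  match t with
  | U => (false, false) | W => (false, true)
  | X => (true, false) | Y => (true, true)
  end.

Definition kind_of_bool2 (b : bool * bool) : dp_kind :=
  match b with
  | (false, false) => U | (false, true) => W
  | (true, false) => X | (true, true) => Y
  end.

Lemma bool2_of_kindK : cancel bool2_of_kind kind_of_bool2.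
Proof. by case. Qed.

HB.instance Definition _ := Finite.copy dp_kind (can_type bool2_of_kindK).

Definition dp_vertex (n : nat) : finType := (dp_kind * 'I_n)%type.

(** Each edge listed in one direction. *)
Definition dp_arc (n k : nat) (a b : dp_vertex n) : bool :=
  let: (s, i) := a in
  let: (t, j) := b in
  match s, t with
  | U, U | X, X => j == i + 1 %[mod n]
  | W, Y | Y, W => j == i + k %[mod n]
  | U, W | X, Y => j == i
  | _, _ => false
  end.

Definition DP (n k : nat) : rel (dp_vertex n) :=
  fun a b => dp_arc k a b || dp_arc k b a.
Arguments DP : clear implicits.

Lemma DP_sym n k : symmetric (DP n k).
Proof. by move=> a b; rewrite /DP orbC. Qed.

Lemma DP_irrefl n k : 1 < n -> irreflexive (DP n k).
Proof.
move=> n_gt1 [s i]; rewrite /DP orbb.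
have Hi : (i == i + 1 %[mod n]) = false.
  by rewrite -{1}[i : nat]addn0 eqn_modDl mod0n modn_small.
by case: s => //=.
Qed.

(* Main.v *)
(* Call an edge outer, spoke or inner according to its ends.  The three classes have
   equally many edges, so in a [1,lambda,8]-cycle regular graph the 8-cycles contain in
   total equally many edges of each class.  The 8-cycle
   u_0 u_1 w_1 y_{k+1} x_{k+1} x_k y_k w_0 has two outer, four spoke and two inner edges,
   so some 8-cycle has more outer edges than spokes and some 8-cycle has more inner edges
   than spokes.  A walk changes subscripts by a + b k for small integers a and b that are
   determined by its sequence of steps, and closes up only if n divides a + b k; listing
   the closed non-backtracking words of length 8, the first kind of cycle requires n | 8
   or n | 4 +- 2k, the second n | 8k or n | 2 +- 4k.  Together these force n <= 16, and
   direct counts through one edge of each class leave (5,2), (10,2) and (10,3).  Shifting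
   the subscripts of all x_i and y_i by 5 is an isomorphism from DP(10,3) to DP(10,2). *)
Require Import Defs.
From mathcomp Require Import all_boot all_order all_algebra zify ring.

Set Implicit Arguments.
Unset Strict Implicit.
Unset Printing Implicit Defensive.

Import GRing.Theory.

(** * Cycles through an edge as vertex sequences *)

Lemma set2_inj (T : finType) (a b c d : T) :
  [set a; b] = [set c; d] -> (a = c /\ b = d) \/ (a = d /\ b = c).
Proof.
move=> E.
have: a \in [set c; d] by rewrite -E set21.
have: b \in [set c; d] by rewrite -E set22.
have: c \in [set a; b] by rewrite E set21.
have: d \in [set a; b] by rewrite E set22.
rewrite !inE => /orP[] /eqP Ed /orP[] /eqP Ec /orP[] /eqP Eb /orP[] /eqP Ea;
  by [left; split; congruence | right; split; congruence].
Qed.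

Section CyclesThroughEdge.
Variable V : finType.
Implicit Types (x y v : V) (p c : seq V).

Lemma cycle_edges_rot i p : uniq p -> cycle_edges (rot i p) = cycle_edges p.
Proof.
move=> Up; rewrite /cycle_edges; apply/setP=> E.
by apply/imsetP/imsetP=> -[z]; rewrite ?mem_rot => zp ->; exists z;
  rewrite ?mem_rot ?next_rot.
Qed.

Lemma cycle_edges_rev p : uniq p -> cycle_edges (rev p) = cycle_edges p.
Proof.
move=> Up; apply/setP=> E; apply/imsetP/imsetP=> -[z]; rewrite ?mem_rev => zp ->.
  by exists (prev p z); rewrite ?mem_prev // next_rev // next_prev // setUC.
by exists (next p z); rewrite ?mem_rev ?mem_next // next_rev // prev_next // setUC.
Qed.

Lemma next2_neq p v : uniq p -> 2 < size p -> v \in p -> next p (next p v) != v.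
Proof.
move=> Up szp /rot_to [i s def_p].
rewrite -!(next_rot i Up) def_p.
have: uniq (rot i p) by rewrite rot_uniq.
have: 2 < size (rot i p) by rewrite size_rot.
rewrite def_p; case: s {def_p} => [|a [|b s]] //= _.
rewrite !inE eqxx => /and3P[/norP[va /norP[vb _]] /norP[ab _] _].
by rewrite [a == v]eq_sym (negPf va) eqxx eq_sym.
Qed.

Lemma seq_traject_next x p : uniq (x :: p) ->
  x :: p = traject (next (x :: p)) x (size p).+1.
Proof.
move=> /cycle_next; set f := next _; rewrite /= rcons_path => /andP[/fpathP[m ->] _].
by rewrite size_traject.
Qed.

(* A cycle is recovered from its edge set and its first two vertices: of the two
   edges at each new vertex, one leads back to the previous vertex. *)
Lemma cycle_edges_inj x y p1 p2 :
    uniq [:: x, y & p1] -> uniq [:: x, y & p2] -> size p1 = size p2 -> 0 < size p1 ->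
  cycle_edges [:: x, y & p1] = cycle_edges [:: x, y & p2] -> p1 = p2.
Proof.
move=> U1 U2 sz sz0 eqE.
suff: [:: x, y & p1] = [:: x, y & p2] by case.
rewrite (seq_traject_next U1) (seq_traject_next U2).
have -> : size (y :: p1) = size (y :: p2) by rewrite /= sz.
have [f fE] : exists f, f = next [:: x, y & p1] by exists (next [:: x, y & p1]).
have [g gE] : exists g, g = next [:: x, y & p2] by exists (next [:: x, y & p2]).
rewrite -fE -gE.
have iterP i : iter i f x = iter i g x /\ iter i.+1 f x = iter i.+1 g x.
  elim: i => [|i [IH0 IH1]]; first by rewrite fE gE /= !eqxx.
  split=> //; rewrite (iterS i.+1 f) (iterS i.+1 g) -IH1.
  move: IH1; rewrite !iterS -IH0.
  have: iter i f x \in [:: x, y & p1].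
    elim: i {IH0} => [|i IHi]; first exact: mem_head.
    by rewrite iterS {1}fE mem_next.
  move: (iter i f x) => u up uE.
  have : [set f u; f (f u)] \in cycle_edges [:: x, y & p2].
    by rewrite -eqE fE; apply: imset_f; rewrite mem_next.
  case/imsetP=> z _ /set2_inj; rewrite -gE => -[[-> ->] //|[fu fz]].
  (* In the crossed case [z = f (f u)] has the same [g]-successor as [u], so it equals [u], which is
     impossible in a cycle of length at least 3. *)
  have /eqP[] : f (f u) != u by rewrite fE; apply: next2_neq.
  by apply: (can_inj (prev_next U2)); rewrite -gE fz -fu.
apply: (@eq_from_nth _ x); rewrite ?size_traject // => i im.
by rewrite !nth_traject //; case: (iterP i).
Qed.

(** Of the sequences tracing a cycle through this edge, exactly one begins with [x, y]: the directed
    edge fixes rotation and orientation, and [cycle_edges_inj] recovers the rest. *)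
Lemma card_cycles_through_edge (e : rel V) m x y : 0 < m -> symmetric e -> x != y ->
  #|[set C | is_cycle e m.+2 C & path_in_cycle x [:: y] C]| =
  #|[set c : m.-tuple V | ucycleb e [:: x, y & c]]|.
Proof.
move=> m0 e_sym xy.
have inj : {in [set c : m.-tuple V | ucycleb e [:: x, y & c]] &,
    injective (fun c : m.-tuple V => cycle_edges [:: x, y & c])}.
  move=> c1 c2; rewrite !inE => /andP[_ U1] /andP[_ U2] E.
  by apply: val_inj; apply: cycle_edges_inj E; rewrite ?size_tuple.
rewrite -(card_in_imset inj); apply: eq_card => C; rewrite inE.
apply/idP/imsetP => [|[c]]; last first.
  rewrite inE => uc ->; apply/andP; split.
    rewrite /is_cycle !ltnS m0; apply/existsP.
    by exists [tuple of [:: x, y & c]]; rewrite uc eqxx.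
  have xyE : [set x; y] \in cycle_edges [:: x, y & c].
    by apply/imsetP; exists x; rewrite ?mem_head //= eqxx.
  rewrite /path_in_cycle /= xyE !andbT.
  by rewrite !(subsetP (bigcup_sup _ xyE)) ?set21 ?set22.
case/andP=> /andP[_ /existsP[c /andP[uc /eqP->]]] /andP[_]; rewrite /= andbT.
(* A sequence running from [x] to [y] is rotated until it starts at [x]; one running from [y] to [x]
   is reversed first. *)
have fwd (c' : m.+2.-tuple V) : ucycleb e c' -> x \in c' -> next c' x = y ->
    exists2 c0 : m.-tuple V, c0 \in [set c : m.-tuple V | ucycleb e [:: x, y & c]] &
    cycle_edges c' = cycle_edges [:: x, y & c0].
  move=> uc' xc' nx; have U' : uniq c' by case/andP: uc'.
  case: (rot_to xc') => i s def_c.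
  have sz : size (rot i c') = m.+2 by rewrite size_rot size_tuple.
  move: sz uc' nx; rewrite /ucycleb -(rot_cycle i) -[uniq c'](rot_uniq i).
  rewrite -(next_rot i) // -(cycle_edges_rot i) // def_c.
  case: s {def_c} => [|z s] //= [sz]; rewrite eqxx => uc' zy; rewrite {z}zy in uc' *.
  by exists (tcast sz (in_tuple s)); rewrite ?inE val_tcast.
have U : uniq c by case/andP: uc.
case/imsetP=> z zc /set2_inj[[xz yz]|[xz yz]]; first by apply: fwd => //; rewrite xz.
rewrite -(cycle_edges_rev U); apply: (fwd [tuple of rev c]).
- rewrite /ucycleb rev_uniq U andbT rev_cycle.
  by rewrite (eq_cycle (e' := e)) //; case/andP: uc.
- by rewrite mem_rev xz mem_next.
by rewrite next_rev // xz prev_next.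
Qed.

End CyclesThroughEdge.

(** * Double counting of arcs on cycles *)

(** Pairing with [rot 1 c] makes the count cyclic: the arc from the last entry back to the first is
    included. *)
Definition count_arcs (T : Type) (Q : rel T) (c : seq T) : nat :=
  count (fun p => Q p.1 p.2) (zip c (rot 1 c)).

Section DoubleCounting.
Variables (V : finType) (e Q : rel V) (m lambda : nat).
Hypothesis card_arc : forall x y, Q x y ->
  #|[set c : m.-tuple V | ucycleb e [:: x, y & c]]| = lambda.

Lemma sum_first_arc :
  \sum_(c : m.+2.-tuple V | ucycleb e c) (Q (thead c) (thead (behead_tuple c)) : nat)
    = lambda * #|[set p | Q p.1 p.2]|.
Proof.
rewrite -big_mkcondr.
rewrite (partition_big (fun c : m.+2.-tuple V => (thead c, thead (behead_tuple c)))
  (fun p => p \in [set p | Q p.1 p.2])) /=; last first.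
  by move=> c /andP[_ Qc]; rewrite inE.
rewrite mulnC -sum_nat_const; apply: eq_bigr => -[x y]; rewrite inE /= => Qxy.
rewrite -(card_arc Qxy) sum1dep_card.
have inj : injective (fun c : m.-tuple V => [tuple of [:: x, y & c]]).
  by move=> c1 c2 /(congr1 val) [E]; apply: val_inj.
rewrite -(card_imset _ inj); apply: eq_card => c.
rewrite [in LHS]inE; apply/idP/imsetP.
  case/tupleP: c => x' c; case/tupleP: c => y' c.
  rewrite theadE => /andP[/andP[uc _] /eqP[ex ey]].
  have {}ey : y' = y by rewrite -ey /thead (tnth_nth y').
  by exists c; rewrite ?inE -?ex -?ey //; apply: val_inj.
case=> c'; rewrite inE => uc ->; rewrite uc theadE.
have -> : thead (behead_tuple [tuple of [:: x, y & c']]) = y by rewrite /thead (tnth_nth y).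
by rewrite Qxy eqxx.
Qed.

(** Rotating by [j] brings the [j]-th arc to the front and permutes the cyclic sequences, so each of
    the [m.+2] positions contributes the sum of [sum_first_arc]. *)
Lemma sum_count_arcs :
  \sum_(c : m.+2.-tuple V | ucycleb e c) count_arcs Q c
    = m.+2 * (lambda * #|[set p | Q p.1 p.2]|).
Proof.
have cE (c : m.+2.-tuple V) : count_arcs Q c =
    \sum_(j < m.+2) (Q (thead [tuple of rot j c])
                       (thead (behead_tuple [tuple of rot j c])) : nat).
  rewrite /count_arcs; set x0 := thead c.
  have -> : zip c (rot 1 c) = mkseq (fun j => (nth x0 (rot j c) 0, nth x0 (rot j c) 1)) m.+2.
    apply: (@eq_from_nth _ (x0, x0)).
      by rewrite size_zip size_rot size_mkseq size_tuple minnn.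
    move=> j; rewrite size_zip size_rot size_tuple minnn => jm.
    rewrite nth_zip ?size_rot // nth_mkseq //; congr (_, _).
      by rewrite /rot nth_cat size_drop size_tuple subn_gt0 jm nth_drop addn0.
    rewrite /rot !nth_cat !size_drop !size_tuple subn1 ltn_subRL addn1 !nth_drop.
    case: (ltnP j.+1 m.+2) => jm1; first by rewrite -ltnS jm1 add1n addn1.
    (* At the last position the successor wraps round to entry 0. *)
    have -> : j = m.+1 by apply/eqP; rewrite eqn_leq -ltnS jm.
    by rewrite /= ltnn subSnn !subnn !nth_take.
  rewrite /mkseq count_map -sum1_count big_mkcond -[iota 0 m.+2]/(index_iota 0 m.+2) big_mkord.
  apply: eq_bigr => j _; rewrite /= /thead !(tnth_nth x0) /= nth_behead.
  by case: (Q _ _).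
rewrite (eq_bigr _ (fun c _ => cE c)) exchange_big /=.
rewrite -[in RHS](card_ord m.+2) -sum_nat_const; apply: eq_bigr => j _.
rewrite -sum_first_arc [RHS](reindex (fun c : m.+2.-tuple V => [tuple of rot j c])) /=.
  by apply: eq_bigl => c; rewrite /ucycleb rot_cycle rot_uniq.
exists (fun c : m.+2.-tuple V => [tuple of rotr j c]) => c _; apply: val_inj => /=.
  exact: rotK.
exact: rotrK.
Qed.

End DoubleCounting.

Lemma sum_eq_exists_gt (I : finType) (P : pred I) (f g : I -> nat) i0 :
    P i0 -> f i0 < g i0 -> \sum_(i | P i) f i = \sum_(i | P i) g i ->
  exists2 i, P i & g i < f i.
Proof.
move=> Pi0 fg0 eqS; apply/exists_inP; apply: contraT => /exists_inPn fg.
suff: \sum_(i | P i) f i < \sum_(i | P i) g i by rewrite eqS ltnn.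
rewrite (bigD1 i0) // [ltnRHS](bigD1 i0) //= -addSn leq_add // leq_sum // => i.
by case/andP=> /fg; rewrite -leqNgt.
Qed.

(** * Words of steps and their displacements *)

Definition outer_kind (t : dp_kind) := match t with U | X => true | W | Y => false end.

Definition outer_arc (t t' : dp_kind) := outer_kind t && outer_kind t'.
Definition spoke_arc (t t' : dp_kind) := outer_kind t (+) outer_kind t'.
Definition inner_arc (t t' : dp_kind) := ~~ outer_kind t && ~~ outer_kind t'.

Variant step := Fwd | Bwd | Spoke.

Definition is_step_opp s s' :=
  match s, s' with Fwd, Bwd | Bwd, Fwd | Spoke, Spoke => true | _, _ => false end.

Definition move s t :=
  match s, t with
  | Spoke, U => W | Spoke, W => U | Spoke, X => Y | Spoke, Y => X
  | _, U => U | _, X => X | _, W => Y | _, Y => W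
  end.

(* A walk with total [outer_disp] a and total [inner_disp] b changes the subscript by
   a + b * k modulo n. *)
Definition step_sign s : int := match s with Fwd => 1%Z | Bwd => (-1)%Z | Spoke => 0%Z end.
Definition outer_disp s t : int := if outer_kind t then step_sign s else 0%Z.
Definition inner_disp s t : int := if outer_kind t then 0%Z else step_sign s.

Fixpoint word_kinds t w := if w is s :: w' then t :: word_kinds (move s t) w' else [::].
Fixpoint word_end t w := if w is s :: w' then word_end (move s t) w' else t.
Fixpoint word_disp (d : step -> dp_kind -> int) t w : int :=
  if w is s :: w' then (d s t + word_disp d (move s t) w')%R else 0%Z.

Fixpoint words m : seq (seq step) :=
  if m is m'.+1 then [seq s :: w | s <- [:: Fwd; Bwd; Spoke], w <- words m'] else [:: [::]].

(** The premise selects words that return to their first kind and never backtrack, not even across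
    the closing point, as [count_arcs] is cyclic. Signs of the displacements are dropped here and
    treated in [dvd_absz_cases]. *)
Definition word_test t w :=
  let c q := count_arcs q (word_kinds t w) in
  let a := `|word_disp outer_disp t w|%N in
  let b := `|word_disp inner_disp t w|%N in
  (word_end t w == t) && (count_arcs is_step_opp w == 0) ==>
  [&& (c spoke_arc < c outer_arc) ==> ((a == 8) && (b == 0) || (a == 4) && (b == 2))
    & (c spoke_arc < c inner_arc) ==> ((a == 0) && (b == 8) || (a == 2) && (b == 4))].

Lemma word_test8 : all (fun t => all (word_test t) (words 8)) [:: U; W; X; Y].
Proof. by vm_compute. Qed.

Lemma all_words (P : pred (seq step)) w : all P (words (size w)) -> P w.
Proof.
elim: w P => [|s w IHw] P /=; first by rewrite andbT.
rewrite !all_cat !all_map => /and4P[F B S _].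
by case: s; apply: (IHw (fun w => P (_ :: w))).
Qed.

Section Steps.
Variables n k : nat.
Implicit Types x y z : dp_vertex n.

Definition is_step s x y : Prop :=
  y.1 = move s x.1 /\
  (n %| ((y.2%:Z - x.2%:Z) - (outer_disp s x.1 + inner_disp s x.1 * k%:Z))%R)%Z.

Lemma DP_step x y : DP n k x y -> exists s, is_step s x y.
Proof.
have fwd (i j a : nat) : i == j + a %[mod n] -> (n %| (i%:Z - j%:Z - a%:Z)%R)%Z.
  by rewrite -addrA -opprD -PoszD -eqz_mod_dvd !modz_nat.
have bwd (i j a : nat) : i == j + a %[mod n] -> (n %| (j%:Z - i%:Z + a%:Z)%R)%Z.
  have -> : (j%:Z - i%:Z + a%:Z = - (i%:Z - j%:Z - a%:Z))%R by ring.
  by rewrite rpredN; apply: fwd.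
have eqd (a b : int) : a = b -> (n %| a)%Z -> (n %| b)%Z by move->.
have spoke (i j : 'I_n) : i == j -> (n %| (i%:Z - j%:Z - (0 + 0 * k%:Z))%R)%Z.
  by move/eqP->; rewrite mul0r subrr.
case: x y => [[] i] [[] j]; rewrite /DP /dp_arc /= ?orbF // /is_step /=.
all: try by (move=> /spoke d; exists Spoke; split).
all: try by (rewrite eq_sym => /spoke d; exists Spoke; split).
all: try by (case/orP=> [/fwd d|/bwd d]; [exists Fwd|exists Bwd]; split=> //;
  apply: eqd d; rewrite /outer_disp /inner_disp /=; ring).
Qed.

(** The two displacements cancel, so the subscripts of [x] and [z] are congruent modulo [n]; both
    being below [n], they are equal. *)
Lemma is_step_backtrack s s' x y z :
  is_step s x y -> is_step s' y z -> is_step_opp s s' -> z = x.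
Proof.
case: x y z => [t i] [t' j] [t'' l] [/= -> d1] [/= -> d2] opp.
have tE : move s' (move s t) = t by case: t {d1 d2}; case: s opp; case: s'.
rewrite tE; congr (_, _); apply: ord_inj.
have {d1 d2} : (n %| (l%:Z - i%:Z)%R)%Z.
  have -> : (l%:Z - i%:Z =
      (l%:Z - j%:Z - (outer_disp s' (move s t) + inner_disp s' (move s t) * k%:Z)) +
      (j%:Z - i%:Z - (outer_disp s t + inner_disp s t * k%:Z)))%R.
    case: s opp tE {d1 d2}; case: s' => //= _; case: t => //= _;
      rewrite /outer_disp /inner_disp /=; ring.
  exact: rpredD.
have := ltn_ord i; have := ltn_ord l; rewrite -eqz_mod_dvd !modz_nat => hl hi.
by rewrite !modn_small // => /eqP[].
Qed.

(** Vertices two apart on an 8-cycle are distinct, which excludes backtracking. *)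
Lemma cycle8_word (c : 8.-tuple (dp_vertex n)) : ucycleb (DP n k) c ->
  exists t w, [/\ size w = 8, word_kinds t w = map fst c,
    (word_end t w == t) && (count_arcs is_step_opp w == 0) &
    (n %| (word_disp outer_disp t w + word_disp inner_disp t w * k%:Z)%R)%Z].
Proof.
case: c => [[|v0 [|v1 [|v2 [|v3 [|v4 [|v5 [|v6 [|v7 []]]]]]]]]] // i.
rewrite /ucycleb => /andP[]; rewrite [tval _]/= [cycle _ _]/=.
case/and5P=> /DP_step[s0 h0] /DP_step[s1 h1] /DP_step[s2 h2] /DP_step[s3 h3].
case/and5P=> /DP_step[s4 h4] /DP_step[s5 h5] /DP_step[s6 h6] /DP_step[s7 h7] _ Uc.
exists v0.1, [:: s0; s1; s2; s3; s4; s5; s6; s7].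
pose vs := [:: v0; v1; v2; v3; v4; v5; v6; v7].
have neq a b : a < 8 -> b < 8 -> a != b -> nth v0 vs a != nth v0 vs b.
  by move=> a8 b8 ab; rewrite (nth_uniq v0 _ _ Uc).
have back s s' x y z : is_step s x y -> is_step s' y z -> x != z -> is_step_opp s s' = false.
  by move=> hs hs' xz; apply: contraNF xz => /(is_step_backtrack hs hs') ->.
have nopp : count_arcs is_step_opp [:: s0; s1; s2; s3; s4; s5; s6; s7] == 0.
  rewrite /count_arcs /=.
  rewrite (back _ _ _ _ _ h0 h1 (neq 0 2 isT isT isT)).
  rewrite (back _ _ _ _ _ h1 h2 (neq 1 3 isT isT isT)).
  rewrite (back _ _ _ _ _ h2 h3 (neq 2 4 isT isT isT)).
  rewrite (back _ _ _ _ _ h3 h4 (neq 3 5 isT isT isT)).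
  rewrite (back _ _ _ _ _ h4 h5 (neq 4 6 isT isT isT)).
  rewrite (back _ _ _ _ _ h5 h6 (neq 5 7 isT isT isT)).
  rewrite (back _ _ _ _ _ h6 h7 (neq 6 0 isT isT isT)).
  by rewrite (back _ _ _ _ _ h7 h0 (neq 7 1 isT isT isT)).
move: h0 h1 h2 h3 h4 h5 h6 h7; move=> [e1 d0] [e2 d1] [e3 d2] [e4 d3].
move=> [e5 d4] [e6 d5] [e7 d6] [e0 d7].
rewrite nopp andbT /=.
rewrite -e1 -e2 -e3 -e4 -e5 -e6 -e7 -e0 eqxx; split=> //.
(* The negated total displacement is the sum of the eight quantities divisible by [n] in [is_step],
   because the subscript differences telescope to 0 around the cycle. *)
rewrite -rpredN.
set D := (X in X \in _).
have -> : D = (((v1.2%:Z - v0.2%:Z) - (outer_disp s0 v0.1 + inner_disp s0 v0.1 * k%:Z))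
 + ((v2.2%:Z - v1.2%:Z) - (outer_disp s1 v1.1 + inner_disp s1 v1.1 * k%:Z))
 + ((v3.2%:Z - v2.2%:Z) - (outer_disp s2 v2.1 + inner_disp s2 v2.1 * k%:Z))
 + ((v4.2%:Z - v3.2%:Z) - (outer_disp s3 v3.1 + inner_disp s3 v3.1 * k%:Z))
 + ((v5.2%:Z - v4.2%:Z) - (outer_disp s4 v4.1 + inner_disp s4 v4.1 * k%:Z))
 + ((v6.2%:Z - v5.2%:Z) - (outer_disp s5 v5.1 + inner_disp s5 v5.1 * k%:Z))
 + ((v7.2%:Z - v6.2%:Z) - (outer_disp s6 v6.1 + inner_disp s6 v6.1 * k%:Z))
 + ((v0.2%:Z - v7.2%:Z) - (outer_disp s7 v7.1 + inner_disp s7 v7.1 * k%:Z)))%R.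
  by rewrite /D; ring.
by do 7 (apply: rpredD; last by []).
Qed.
End Steps.

(** * Neighbour lists and the sizes of the edge classes *)

Lemma card_enumerated (T : finType) (S : eqType) (f : T -> S) (A : {pred T}) (L : seq S) :
    injective f -> uniq L -> (forall y, (y \in A) = (f y \in L)) ->
  (forall l, l \in L -> exists y, l = f y) -> #|A| = size L.
Proof.
move=> inj_f UL AL Lf; rewrite cardE -(size_map f); apply/perm_size/uniq_perm => //.
  by rewrite map_inj_uniq ?enum_uniq.
move=> l; apply/mapP/idP => [[y]|lL]; first by rewrite mem_enum AL => ? ->.
by case: (Lf l lL) => y ly; exists y; rewrite // mem_enum AL -ly.
Qed.

Section Neighbours.
Variables n k : nat.
Hypotheses (hn : 3 <= n) (hk1 : 1 <= k) (hk2 : 2 * k < n).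
Implicit Types x y : dp_vertex n.

(** Subscripts in [nat] let closed walks be evaluated by [vm_compute]. *)
Definition code (x : dp_vertex n) : dp_kind * nat := (x.1, x.2 : nat).

Definition nbrs (v : dp_kind * nat) : seq (dp_kind * nat) :=
  let: (t, i) := v in
  let d := if outer_kind t then 1 else k in
  [:: (move Fwd t, (i + d) %% n); (move Bwd t, (i + (n - d)) %% n); (move Spoke t, i)].

Lemma code_inj : injective code.
Proof. by move=> [t i] [t' j] [-> /ord_inj ->]. Qed.

Lemma code_surj t i : i < n -> exists x, (t, i) = code x.
Proof. by move=> i_n; exists (t, Ordinal i_n). Qed.

Lemma mem_nbrs x y : (code y \in nbrs (code x)) = DP n k x y.
Proof.
have fwd (i j : 'I_n) d : (j == (i + d) %% n :> nat) = (j == i + d %[mod n]).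
  by rewrite [j %% n]modn_small.
have bwd (i j : 'I_n) d : d < n -> (j == i + (n - d) %[mod n]) = (i == j + d %[mod n]).
  move=> dn; rewrite -(eqn_modDr d).
  by rewrite -addnA subnK ?modnDr 1?eq_sym // ltnW.
have n1 : 1 < n by lia.
have kn : k < n by lia.
case: x y => [t i] [t' j]; rewrite /DP /dp_arc /code !inE !xpair_eqE /=.
by case: t; case: t'; rewrite /= ?orbF ?fwd ?bwd ?[i == j]eq_sym.
Qed.

(** The forward and backward neighbours are told apart by [2 * d < n], where [d] is 1 or [k]; the
    spoke neighbour has a different kind. *)
Lemma uniq_nbrs v : uniq (nbrs v).
Proof.
have neq i d : 0 < d -> 2 * d < n -> (i + d == i + (n - d) %[mod n]) = false.
  move=> d0 dn; rewrite eqn_modDl !modn_small; lia.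
case: v => t i; rewrite /= !inE !negb_or !xpair_eqE.
by case: t; rewrite /= ?neq //; lia.
Qed.

Lemma nbrs_code x l : l \in nbrs (code x) -> exists y, l = code y.
Proof.
have n0 : 0 < n by lia.
case: x => t i; rewrite !inE => /or3P[] /eqP->; apply: code_surj => //=; exact: ltn_pmod.
Qed.

Definition dp_class (q : rel dp_kind) : rel (dp_vertex n) :=
  fun x y => DP n k x y && q x.1 y.1.

Lemma card_dp_class q :
  #|[set p | dp_class q p.1 p.2]| = \sum_x count (fun t => q x.1 t) (map fst (nbrs (code x))).
Proof.
rewrite -sum1dep_card -(pair_big_dep xpredT (dp_class q) (fun _ _ => 1)).
apply: eq_bigr => x _; rewrite sum1_card count_map -size_filter.
apply: (card_enumerated code_inj); first by rewrite filter_uniq ?uniq_nbrs.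
  by move=> y; rewrite mem_filter mem_nbrs andbC.
by move=> l; rewrite mem_filter => /andP[_]; apply: nbrs_code.
Qed.

(** Each vertex has one spoke neighbour and two others, both along outer or both along inner edges,
    so outer and inner arcs together are twice the spoke arcs. Swapping the ends of every spoke
    exchanges the outer and inner counts. *)
Lemma card_dp_class_spoke :
  #|[set p | dp_class outer_arc p.1 p.2]| = #|[set p | dp_class spoke_arc p.1 p.2]| /\
  #|[set p | dp_class inner_arc p.1 p.2]| = #|[set p | dp_class spoke_arc p.1 p.2]|.
Proof.
rewrite !card_dp_class.
pose flip x : dp_vertex n := (move Spoke x.1, x.2).
have flipK : involutive flip by case=> [[] i].
have E : \sum_x count (fun t => outer_arc x.1 t) (map fst (nbrs (code x))) =
         \sum_x count (fun t => inner_arc x.1 t) (map fst (nbrs (code x))).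
  by rewrite (reindex_inj (inv_inj flipK)); apply: eq_bigr => [[[] i]] _.
suff : \sum_x count (fun t => outer_arc x.1 t) (map fst (nbrs (code x))) +
       \sum_x count (fun t => inner_arc x.1 t) (map fst (nbrs (code x))) =
  2 * \sum_x count (fun t => spoke_arc x.1 t) (map fst (nbrs (code x))) by rewrite E; lia.
by rewrite -big_split big_distrr; apply: eq_bigr => [[[] i]] _.
Qed.
End Neighbours.

(** * Enumeration of closed walks *)

Fixpoint walks n k m (v : dp_kind * nat) : seq (seq (dp_kind * nat)) :=
  if m is m'.+1 then flatten [seq map (cons w) (walks n k m' w) | w <- nbrs n k v]
  else [:: [::]].

Lemma walksS n k m v :
  walks n k m.+1 v = flatten [seq map (cons w) (walks n k m w) | w <- nbrs n k v].
Proof. by []. Qed.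

(** Here [s] continues the arc from [v] to [w], so 8-cycles correspond to [m = 6]. The [undup]
    supplies the uniqueness that [card_enumerated] asks for. *)
Definition closed_walks n k m v w :=
  undup [seq s <- walks n k m w | uniq [:: v, w & s] && (v \in nbrs n k (last w s))].

Section ClosedWalks.
Variables n k : nat.
Hypotheses (hn : 3 <= n) (hk1 : 1 <= k) (hk2 : 2 * k < n).
Implicit Types x y : dp_vertex n.

Lemma mem_walks m y c :
  (map (@code n) c \in walks n k m (code y)) = (size c == m) && path (DP n k) y c.
Proof.
elim: m y c => [|m IHm] y [|z c] //; rewrite walksS.
  by apply/negbTE/negP=> /flattenP[_ /mapP[w _ ->]] /mapP[].
rewrite [size _]/= eqSS [path _ _ _]/= andbCA -IHm -mem_nbrs //; apply/flattenP/andP.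
  case=> _ /mapP[w wy ->] /mapP[s sw [zw cs]].
  by rewrite zw wy cs.
case=> zy cz; exists (map (cons (code z)) (walks n k m (code z))).
  exact: (map_f (fun w => map (cons w) (walks n k m w))).
exact: map_f.
Qed.

Lemma walks_code m y s : s \in walks n k m (code y) -> exists c, s = map (@code n) c.
Proof.
elim: m y s => [|m IHm] y s; first by rewrite inE => /eqP->; exists [::].
rewrite walksS; case/flattenP=> _ /mapP[w wy ->] /mapP[s' s'w ->].
have [z wz] := nbrs_code hn hk1 hk2 wy; rewrite wz in s'w *.
by have [c ->] := IHm _ _ s'w; exists (z :: c).
Qed.

Lemma card_closed_walks m x y : DP n k x y ->
  #|[set c : m.-tuple (dp_vertex n) | ucycleb (DP n k) [:: x, y & c]]| =
  size (closed_walks n k m (code x) (code y)).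
Proof.
move=> exy; have inj : injective (fun c : m.-tuple (dp_vertex n) => map (@code n) c).
  by move=> c c' /(inj_map (@code_inj n)) /val_inj.
have memE (c : seq (dp_vertex n)) :
    (map (@code n) c \in closed_walks n k m (code x) (code y)) =
    (size c == m) && ucycleb (DP n k) [:: x, y & c].
  rewrite mem_undup mem_filter mem_walks last_map mem_nbrs //.
  rewrite -!map_cons (map_inj_uniq (@code_inj n)) /ucycleb /= rcons_path exy /=.
  by case: (size c == m); case: (path _ _ _); rewrite /= ?andbF // andbT andbC.
apply: (card_enumerated inj); first exact: undup_uniq.
  by move=> c; rewrite memE inE size_tuple eqxx.
move=> s sL; move: (sL); rewrite mem_undup mem_filter => /andP[_ /walks_code[c sc]].
move: sL; rewrite sc memE => /andP[sz _].
by exists (Tuple sz).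
Qed.
End ClosedWalks.

(** The closing condition that [n] divides [a + b * k], with absolute values (8, 0) or (4, 2) and
    with equal or opposite signs; [inner_excess_cond] does the same for (0, 8) and (2, 4). *)
Definition outer_excess_cond n k :=
  [|| n %| 8, n %| 2 * k + 4 | 2 * k == 4 %[mod n]].

Definition inner_excess_cond n k :=
  [|| n %| 8 * k, n %| 4 * k + 2 | 4 * k == 2 %[mod n]].

Definition equal_counts n k :=
  let N v w := size (closed_walks n k 6 v w) in
  (N (U, 0) (U, 1) == N (U, 0) (W, 0)) && (N (W, 0) (Y, k) == N (U, 0) (W, 0)).

(* [if] rather than [==>], which call-by-value evaluation would not short-circuit. *)
Lemma small_equal_counts :
  all (fun n => all (fun k =>
    if [&& 2 * k < n, outer_excess_cond n k, inner_excess_cond n k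
         & (n, k) \notin [:: (5, 2); (10, 2); (10, 3)]]
    then ~~ equal_counts n k else true) (iota 1 7)) (iota 3 14).
Proof. by vm_compute. Qed.

Lemma count_dp_class n k q (c : 8.-tuple (dp_vertex n)) : ucycleb (DP n k) c ->
  count_arcs (dp_class k q) c = count_arcs q (map fst c).
Proof.
case: c => [[|v0 [|v1 [|v2 [|v3 [|v4 [|v5 [|v6 [|v7 []]]]]]]]]] // i.
rewrite /ucycleb /= => /andP[/and5P[e0 e1 e2 e3 /and5P[e4 e5 e6 e7 _]] _].
by rewrite /count_arcs /= /dp_class e0 e1 e2 e3 e4 e5 e6 e7.
Qed.

(** * Divisibility conditions from regularity, and the bound on n *)

Section Regular.
Variables n k : nat.
Hypotheses (hn : 3 <= n) (hk1 : 1 <= k) (hk2 : 2 * k < n).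

(** The subscripts 0, 1, [k] and [k.+1] are all below [n], so the cycle exists without any reduction
    modulo [n]. *)
Lemma ladder_cycle : exists2 c : 8.-tuple (dp_vertex n), ucycleb (DP n k) c &
  map fst c = [:: U; U; W; Y; X; X; Y; W].
Proof.
have n0 : 0 < n by lia.
have [n1 nk nk1] : [/\ 1 < n, k < n & k.+1 < n] by split; lia.
pose v t i (h : i < n) : dp_vertex n := (t, Ordinal h).
exists [tuple v U _ n0; v U _ n1; v W _ n1; v Y _ nk1;
             v X _ nk1; v X _ nk; v Y _ nk; v W _ n0] => //.
rewrite /ucycleb /= /DP /= !inE !xpair_eqE /= -!val_eqE /= !add0n !addn1 add1n.
by rewrite !eqxx ?orbT /=; lia.
Qed.

(** Divisibility ignores an overall sign, so it only matters whether [a] and [b] have equal or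
    opposite signs. *)
Lemma dvd_absz_cases (a b : int) (A B : nat) :
    (n %| (a + b * k%:Z)%R)%Z -> `|a|%N = A -> `|b|%N = B ->
  n %| B * k + A \/ B * k == A %[mod n].
Proof.
move=> d aA bB.
have eqd (x y : int) : x = y -> (n %| x)%Z -> (n %| y)%Z by move->.
have eqdN (x y : int) : x = (- y)%R -> (n %| x)%Z -> (n %| y)%Z by move->; rewrite rpredN.
have modE : (B * k == A %[mod n]) = (n %| ((B * k)%N%:Z - A%:Z)%R)%Z.
  by rewrite -eqz_mod_dvd !modz_nat.
have addE : (n %| B * k + A) = (n %| (B * k + A)%N%:Z)%Z by [].
rewrite modE addE.
have absE (x : int) (m : nat) : `|x|%N = m -> x = Posz m \/ x = (- m%:Z)%R.
  by move=> <-; case: x => p; [left | right; rewrite NegzE].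
case: (absE _ _ aA) => aE; case: (absE _ _ bB) => bE.
- by left; apply: eqd d; rewrite aE bE PoszD PoszM; ring.
- by right; apply: eqdN d; rewrite aE bE PoszM; ring.
- by right; apply: eqd d; rewrite aE bE PoszM; ring.
by left; apply: eqdN d; rewrite aE bE PoszD PoszM; ring.
Qed.

Lemma regular_card_closed (lambda : nat) (x y : dp_vertex n) :
    cycle_regular (DP n k) 1 lambda 8 -> DP n k x y ->
  #|[set c : 6.-tuple (dp_vertex n) | ucycleb (DP n k) [:: x, y & c]]| = lambda.
Proof.
move=> reg exy.
have xy : x != y by apply: contraTneq exy => ->; rewrite DP_irrefl; lia.
rewrite -card_cycles_through_edge //; last exact: DP_sym.
by apply: reg; rewrite //= ?exy // inE xy.
Qed.

(** The ladder cycle has four spokes and fewer [q]-arcs, while the totals over all 8-cycles agree;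
    some other cycle must have the reverse inequality, and its word is returned. *)
Lemma regular_exists_excess (q : rel dp_kind) lambda :
    cycle_regular (DP n k) 1 lambda 8 ->
    #|[set p | @dp_class n k q p.1 p.2]| = #|[set p | @dp_class n k spoke_arc p.1 p.2]| ->
    count_arcs q [:: U; U; W; Y; X; X; Y; W] < 4 ->
  exists t w, [/\ word_test t w,
    (word_end t w == t) && (count_arcs is_step_opp w == 0),
    count_arcs spoke_arc (word_kinds t w) < count_arcs q (word_kinds t w) &
    (n %| (word_disp outer_disp t w + word_disp inner_disp t w * k%:Z)%R)%Z].
Proof.
move=> reg card_q q4.
have sumq q' : \sum_(c : 8.-tuple (dp_vertex n) | ucycleb (DP n k) c)
    count_arcs q' (map fst c) = 8 * (lambda * #|[set p | @dp_class n k q' p.1 p.2]|).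
  rewrite -(@sum_count_arcs _ (DP n k)).
    by apply: eq_bigr => c uc; rewrite count_dp_class.
  by move=> x y /andP[exy _]; apply: regular_card_closed.
have [c0 uc0 c0E] := ladder_cycle.
have [||c] := @sum_eq_exists_gt _ (fun c : 8.-tuple (dp_vertex n) => ucycleb (DP n k) c)
  (fun c => count_arcs q (map fst c)) (fun c => count_arcs spoke_arc (map fst c)) c0 uc0.
- by rewrite c0E.
- by rewrite !sumq card_q.
case/cycle8_word=> t [w [sw kw ew dw]] gt; exists t, w; rewrite kw; split=> //.
have := word_test8; rewrite -sw /= => /and5P[hU hW hX hY _].
by case: t {kw ew dw}; apply: all_words.
Qed.

Lemma regular_conditions lambda : cycle_regular (DP n k) 1 lambda 8 ->
  outer_excess_cond n k && inner_excess_cond n k.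
Proof.
move=> reg; have [cardO cardI] := card_dp_class_spoke hn hk1 hk2.
rewrite /outer_excess_cond /inner_excess_cond; apply/andP; split.
- have [//|t [w []]] := regular_exists_excess reg cardO.
  move=> tw ew gt dw; move: tw; rewrite /word_test ew gt /= => /andP[+ _].
  case/orP=> /andP[/eqP eA /eqP eB]; case: (dvd_absz_cases dw eA eB).
  + by rewrite mul0n add0n => ->.
  + by rewrite mul0n mod0n eq_sym -/(n %| 8) => ->.
  + by move=> ->; rewrite orbT.
  by move=> ->; rewrite !orbT.
have [//|t [w []]] := regular_exists_excess reg cardI.
move=> tw ew gt dw; move: tw; rewrite /word_test ew gt /= => /andP[_ +].
case/orP=> /andP[/eqP eA /eqP eB]; case: (dvd_absz_cases dw eA eB).
- by rewrite addn0 => ->.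
- by rewrite mod0n -/(n %| 8 * k) => ->.
- by move=> ->; rewrite orbT.
by move=> ->; rewrite !orbT.
Qed.

Lemma dvdn_lt4 m : n %| m -> m < 4 * n -> [\/ m = 0, m = n, m = 2 * n | m = 3 * n].
Proof.
have n0 : 0 < n by lia.
case/dvdnP=> q ->; rewrite ltn_pmul2r //.
by case: q => [|[|[|[|q]]]] // _; [apply: Or41 | apply: Or42 | apply: Or43 | apply: Or44]; lia.
Qed.

(** For [n > 16] the outer condition leaves [k = 2] or [n = 2 * k + 4]. In either case the inner
    condition would make [n] divide 16, 10 or 6. *)
Lemma conditions_small : outer_excess_cond n k && inner_excess_cond n k -> n <= 16.
Proof.
rewrite /outer_excess_cond /inner_excess_cond => /andP[hO hI].
case: (leqP n 16) => // n16.
have {hO} : k = 2 \/ n = 2 * k + 4.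
  case/or3P: hO => [/dvdn_leq|/dvdn_lt4[]|]; try lia.
  by rewrite !modn_small; lia.
case=> [k2|n_eq]; case/or3P: hI.
- by rewrite k2 => /dvdn_leq; lia.
- by rewrite k2 => /dvdn_leq; lia.
- by rewrite k2 !modn_small; lia.
- by case/dvdn_lt4; lia.
- by case/dvdn_lt4; lia.
by rewrite eqn_mod_dvd => [/dvdn_lt4[]|]; lia.
Qed.
End Regular.

(** * The exceptional isomorphism and the conclusion *)

(** Modulo 10 the shift turns w_i y_{i+3} into w_i y_{i-2} and y_i w_{i+3} into y_{i+5} w_{i+3},
    which are inner edges for [k = 2]. Outer edges and spokes are preserved because all x_i and y_i
    move together. *)
Lemma DP_10_3_iso : graph_iso (DP 10 3) (DP 10 2).
Proof.
have lt10 i : (i + 5) %% 10 < 10 by rewrite ltn_pmod.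
pose f (x : dp_vertex 10) : dp_vertex 10 :=
  if x.1 is U then x else if x.1 is W then x else (x.1, Ordinal (lt10 x.2)).
have fK : involutive f.
  by case=> [[] i] //; rewrite /f /=; congr (_, _); apply: val_inj;
    rewrite /= modnDml -addnA modnDr modn_small.
exists f; first exact: inv_bij.
move=> [s i] [t j]; have := ltn_ord i; have := ltn_ord j.
by case: s; case: t => //=; rewrite /DP /= -?val_eqE /=; lia.
Qed.

Theorem theorem2 (n k : nat) (hn : 3 <= n) (hk1 : 1 <= k) (hk2 : 2 * k < n)
    (hreg : exists lambda : nat, cycle_regular (DP n k) 1 lambda 8) :
  graph_iso (DP n k) (DP 5 2) \/ graph_iso (DP n k) (DP 10 2).
Proof.
have id_iso m : graph_iso (DP m 2) (DP m 2) by exists id => //; exists id.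
have [lambda reg] := hreg.
have cond := regular_conditions hn hk1 hk2 reg.
have n16 := conditions_small hn hk1 hk2 cond.
have eq_counts : equal_counts n k.
  have size_walks x y : DP n k x y -> size (closed_walks n k 6 (code x) (code y)) = lambda.
    by move=> exy; rewrite -card_closed_walks //; apply: regular_card_closed.
  have [n0 n1 nk] : [/\ 0 < n, 1 < n & k < n] by split; lia.
  pose v t i (h : i < n) : dp_vertex n := (t, Ordinal h).
  have UU := size_walks (v U _ n0) (v U _ n1); have UW := size_walks (v U _ n0) (v W _ n0).
  have WY := size_walks (v W _ n0) (v Y _ nk).
  apply/andP; split; apply/eqP.
    by apply: etrans (UU _) (esym (UW _)); rewrite /DP /= ?add0n ?eqxx.
  by apply: etrans (WY _) (esym (UW _)); rewrite /DP /= ?add0n ?eqxx.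
(* From [n <= 16] and [2 * k < n] follows [k <= 7], so the pair lies in the range evaluated. *)
have /allP/(_ n) := small_equal_counts; rewrite mem_iota => /(_ ltac:(lia)).
move=> /allP/(_ k); rewrite mem_iota => /(_ ltac:(lia)).
have /andP[condO condI] := cond.
rewrite hk2 condO condI eq_counts !andTb; case: ifP => // /negbFE + _.
rewrite !inE => /or3P[] /eqP[-> ->]; [by left; apply: id_iso | by right; apply: id_iso|].
by right; apply: DP_10_3_iso.
Qed.
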